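(* Let, for some $k \in \mathbb{N}$, $\mathcal{C}^k = (A^k_1, \ldots, A^k_{k+1})$ be the chain of co-Büchi automata defined in the context, and let $L^k = \mathcal{L}(A^k_1, \ldots, A^k_{k+1})$. Every first chain element of a COCOA encoding $\Sigma^\omega \setminus L^k$ needs at least $2^k$ many states.
   Context: Automata. A co-Büchi automaton with transition-based acceptance is $(Q,\Sigma,\delta,q_0)$ with finite $Q$, input-complete $\delta\subseteq Q\times\Sigma\times Q\times\{1,2\}$, the color of a transition ($1$ = rejecting, $2$ = accepting) depending only on its source state and letter; a run is accepting if the lowest color occurring infinitely often is $2$ (i.e. rejecting transitions are taken only finitely often), and a word is accepted if it has an accepting run. It is history-deterministic if its nondeterminism can be resolved letter by letter by an advice function of the finite prefix read so far, such that for every accepted word the resulting run is accepting. The chain $\mathcal{C}^k$. The alphabet is $\Sigma=\{a_1,\ldots,a_{2k+1}\}\cup\{X_1,\ldots,X_k\}\cup\{Y_1,\ldots,Y_k\}$. $A^k_1$ has a single state with accepting self-loops for $a_1,\ldots,a_{2k+1},Y_1,\ldots,Y_k$ and rejecting self-loops for $X_1,\ldots,X_k$. For $2\le i\le k+1$, $A^k_i$ is deterministic with states $q^k_{i,0}$ (initial), $q^k_{i,1}$, $q^k_{i,2}$ and the following transitions: - from $q^k_{i,0}$: accepting self-loops for $a_1,\ldots,a_{2k-2i+4}$ and all $Y_m$ with $m\ne i-1$; rejecting self-loops for $a_{2k-2i+5},\ldots,a_{2k+1},X_1,\ldots,X_k$; a rejecting transition to $q^k_{i,1}$ for $Y_{i-1}$;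 - from $q^k_{i,1}$: accepting self-loops for $a_1,\ldots,a_{2k-2i+4},Y_1,\ldots,Y_k$; rejecting self-loops for $a_{2k-2i+5},\ldots,a_{2k+1}$ and all $X_m$ with $m\neq i-1$; a rejecting transition to $q^k_{i,2}$ for $X_{i-1}$; - from $q^k_{i,2}$: accepting self-loops for $a_1,\ldots,a_{2k-2i+3},Y_1,\ldots,Y_k$; rejecting self-loops for $a_{2k-2i+4},\ldots,a_{2k+1},X_1,\ldots,X_k$. For a chain of automata, $\mathcal{L}(A_1,\ldots,A_n)$ is the set of words $w$ such that $w\notin \mathcal{L}(A_1)$ or the highest $i$ with $w\in \mathcal{L}(A_i)$ is even. Natural colors. Here $\mathbb{N}$ contains $0$. Fix an $\omega$-regular language $L$ and write $L|_u=\{w'\in\Sigma^\omega\mid uw'\in L\}$. For $w = w_0w_1\ldots \in \Sigma^\omega$, the word $w_0\ldots w_i \tilde w w_{i+1} w_{i+2}\ldots$ results from a residual language invariant injection of $\tilde w\in\Sigma^*$ at position $i$ if $L|_{w_0\ldots w_i} = L|_{w_0\ldots w_i\tilde w}$. A word $w$ is at home in a color of $i \in \mathbb{N}$ if there exists an (infinite) sequence of injection points $J \subset \mathbb{N}$ such that for all words $w'$ that result from injecting residual language invariant words at word positions in $J$ into $w$, either $w'$ is at home in a color strictly smaller than $i$, or both $w,w' \in L$ and $i$ is even, or both $w,w' \notin L$ and $i$ is odd (for $i=0$ only the latter kind of condition can apply). The natural color of $w$ (w.r.t. $L$) is the minimal color in which $w$ is at home. COCOA. A chain of co-Büchi automata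 (COCOA) for (encoding) $L$ is a sequence $(B_1,\ldots,B_n)$ of history-deterministic co-Büchi automata with transition-based acceptance with $\mathcal{L}(B_1)\supset\cdots\supset\mathcal{L}(B_n)$ such that $B_1$ rejects exactly the words of natural color $0$ w.r.t. $L$ and, for each $1\le i\le n$, the words accepted by $B_i$ but rejected by $B_{i+1}$ (if $i<n$) are exactly those of natural color $i$ w.r.t. $L$. *)

(* Defs.v *)
From mathcomp Require Import all_boot.

Set Implicit Arguments.
Unset Strict Implicit.
Unset Printing Implicit Defensive.

Definition word (A : Type) := nat -> A.
Definition language (A : Type) := word A -> Prop.

Definition wcons (A : Type) (a : A) (w : word A) : word A :=
  fun n => if n is m.+1 then w m else a.

Definition wcat (A : Type) (u : seq A) (w : word A) : word A :=
  foldr (@wcons A) w u.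

(* The colour of a transition is a function of its source state and letter,
   so the transition relation, a subset of Q x A x Q x {1,2}, is split into the
   successor sets [cb_next] and the set [cb_rej] of pairs (state, letter) whose
   transitions have colour 1 (rejecting); the others have colour 2. *)
Record coBuchi (A : Type) := CoBuchi {
  cb_state : finType;
  cb_init : cb_state;
  cb_next : cb_state -> A -> {set cb_state};
  cb_rej : cb_state -> A -> bool;
  cb_complete : forall q a, exists q', q' \in cb_next q a
}.

Definition is_run (A : Type) (B : coBuchi A) (w : word A)
    (r : nat -> cb_state B) : Prop :=
  r 0 = cb_init B /\ forall n, r n.+1 \in cb_next (r n) (w n).

Definition accepting (A : Type) (B : coBuchi A) (w : word A)
    (r : nat -> cb_state B) : Prop :=
  exists N, forall n, N <= n -> ~~ cb_rej (r n) (w n).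

Definition lang (A : Type) (B : coBuchi A) : language A :=
  fun w => exists r : nat -> cb_state B, is_run w r /\ accepting w r.

(* [mkseq w n] is the finite word w_0 ... w_(n-1). *)
Definition history_deterministic (A : Type) (B : coBuchi A) : Prop :=
  exists f : seq A -> cb_state B,
    [/\ f [::] = cb_init B,
        forall u a, f (rcons u a) \in cb_next (f u) a
      & forall w, lang B w -> accepting w (fun n => f (mkseq w n))].

(* A non-empty chain (B_1, ..., B_(n+1)) is a function on 'I_n.+1, where the
   index i : 'I_n.+1 stands for position i.+1 of the chain. *)
Definition chain_lang (A : Type) (n : nat) (B : 'I_n.+1 -> coBuchi A) :
    language A :=
  fun w => ~ lang (B ord0) w \/
    exists i : 'I_n.+1,
      [/\ lang (B i) w, forall j : 'I_n.+1, i < j -> ~ lang (B j) w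
        & ~~ odd i.+1].

Definition residual (A : Type) (L : language A) (u : seq A) : language A :=
  fun w => L (wcat u w).

Definition same_residual (A : Type) (L : language A) (u v : seq A) : Prop :=
  forall w, residual L u w <-> residual L v w.

(* w' = w_0 (u 0) w_1 (u 1) w_2 (u 2) ... *)
Definition interleaved (A : Type) (w : word A) (u : nat -> seq A)
    (w' : word A) : Prop :=
  forall n, let s := flatten (mkseq (fun i => w i :: u i) n) in
    mkseq w' (size s) = s.

(* [u j] is the word injected at position j (the empty word if nothing is
   injected there). Invariance is stated on the prefixes of w itself; as
   residuals are preserved by appending letters, this is the same as requiring
   it on the prefixes in which the earlier injections have been performed. *)
Definition injection (A : Type) (L : language A) (J : nat -> Prop)
    (w w' : word A) : Prop :=
  exists u : nat -> seq A,
    [/\ forall j, u j <> [::] -> J j,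
        forall j, same_residual L (mkseq w j.+1) (mkseq w j.+1 ++ u j)
      & interleaved w u w'].

Definition infinite (J : nat -> Prop) : Prop :=
  forall N, exists2 j, N <= j & J j.

(* The colour strictly decreases in the recursive occurrence. *)
Inductive at_home (A : Type) (L : language A) : nat -> word A -> Prop :=
| AtHome (i : nat) (w : word A) (J : nat -> Prop) of
    infinite J &
    (forall w', injection L J w w' ->
      [\/ exists2 j, j < i & at_home L j w',
          [/\ L w, L w' & ~~ odd i]
        | [/\ ~ L w, ~ L w' & odd i]]) :
    at_home L i w.

Definition natural_color (A : Type) (L : language A) (w : word A) (i : nat) :
    Prop :=
  at_home L i w /\ forall j, at_home L j w -> i <= j.

Record is_cocoa (A : Type) (L : language A) (n : nat)
    (B : 'I_n.+1 -> coBuchi A) : Prop := IsCocoa {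
  cocoa_hd : forall i, history_deterministic (B i);
  cocoa_falling : forall i j : 'I_n.+1, j = i.+1 :> nat ->
    (forall w, lang (B j) w -> lang (B i) w) /\
    (exists w, lang (B i) w /\ ~ lang (B j) w);
  cocoa_color0 : forall w, ~ lang (B ord0) w <-> natural_color L w 0;
  cocoa_color : forall (i : 'I_n.+1) w,
    (lang (B i) w /\ forall j : 'I_n.+1, j = i.+1 :> nat -> ~ lang (B j) w)
      <-> natural_color L w i.+1
}.

(* Indices are shifted: [La j], [LX m], [LY m] are the letters a_(j+1), X_(m+1)
   and Y_(m+1). *)
Inductive letter (k : nat) : Type :=
| La of 'I_(2 * k + 1)
| LX of 'I_k
| LY of 'I_k.

Lemma det_complete (A : Type) (Q : finType) (d : Q -> A -> Q) :
  forall q a, exists q', q' \in [set d q a].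
Proof. by move=> q a; exists (d q a); rewrite inE. Qed.

Definition det_coBuchi (A : Type) (Q : finType) (q0 : Q) (d : Q -> A -> Q)
    (rej : Q -> A -> bool) : coBuchi A :=
  @CoBuchi A Q q0 (fun q a => [set d q a]) rej (@det_complete A Q d).

Definition Aone (k : nat) : coBuchi (letter k) :=
  det_coBuchi tt (fun q _ => q) (fun _ l => if l is LX _ then true else false).

Definition st0 : 'I_3 := @Ordinal 3 0 isT.
Definition st1 : 'I_3 := @Ordinal 3 1 isT.
Definition st2 : 'I_3 := @Ordinal 3 2 isT.

(* The automaton A^k_i for 2 <= i <= k+1; within this range no subtraction is
   truncated. *)
Definition Anext (k i : nat) (q : 'I_3) (l : letter k) : 'I_3 :=
  match val q, l with
  | 0, LY m => if m.+1 == i - 1 then st1 else q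
  | 1, LX m => if m.+1 == i - 1 then st2 else q
  | _, _ => q
  end.

Definition Arej (k i : nat) (q : 'I_3) (l : letter k) : bool :=
  match val q, l with
  | 0, La j => 2 * k + 5 - 2 * i <= j.+1
  | 0, LY m => m.+1 == i - 1
  | 1, La j => 2 * k + 5 - 2 * i <= j.+1
  | _, La j => 2 * k + 4 - 2 * i <= j.+1
  | _, LX _ => true
  | _, LY _ => false
  end.

Definition Alater (k i : nat) : coBuchi (letter k) :=
  det_coBuchi st0 (@Anext k i) (@Arej k i).

Definition chainC (k : nat) (i : 'I_k.+1) : coBuchi (letter k) :=
  if i == ord0 then Aone k else Alater k i.+1.

Definition Lk (k : nat) : language (letter k) := chain_lang (@chainC k).

(* Main.v *)
(** A word of natural color 0 with respect to the complement of [Lk] is one that,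
    after some prefix, visits [q_(i,1)] in every [A_i] with [i >= 2] for ever and
    contains a_(2k+1) infinitely often: then no letter X can be injected without
    changing the residual language, whereas any [A_i] resting in another state
    allows the injection of X_(i-1), which leads into [Lk]. Hence the language of
    the first element of a COCOA tells apart, by the word
    X_m Y_1 ... Y_k (a_(2k+1))^omega, the prefixes made of different sets of
    letters Y. In a history-deterministic automaton the state chosen after a prefix
    determines the residual language, so these 2^k prefixes need different states. *)

Require Import Defs.
From mathcomp Require Import all_boot.
From mathcomp Require Import zify.
From Stdlib Require Import ClassicalEpsilon.

Set Implicit Arguments.
Unset Strict Implicit.
Unset Printing Implicit Defensive.

(** * Prefixes and suffixes of infinite words *)

Section Words.
Variable A : Type.
Implicit Types (u v : seq A) (w x : word A).

Lemma mkseq_wcons a w n : mkseq (wcons a w) n.+1 = a :: mkseq w n.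
Proof. by rewrite /mkseq /= -[1]/(1 + 0) iotaDl -map_comp. Qed.

Lemma mkseq_wcat u w n : mkseq (wcat u w) (size u + n) = u ++ mkseq w n.
Proof. by elim: u => //= a u IH; rewrite addSn mkseq_wcons IH. Qed.

Lemma wcat_shift u w n : wcat u w (size u + n) = w n.
Proof. by elim: u. Qed.

Lemma wcat_cat u v w : wcat (u ++ v) w = wcat u (wcat v w).
Proof. exact: foldr_cat. Qed.

End Words.

(** * Existence and letters of words that result from injections *)

Section Interleaving.
Variables (A : Type) (w : word A) (u : nat -> seq A).

Definition interleave_prefix n : seq A := flatten (mkseq (fun i => w i :: u i) n).
Local Notation s := interleave_prefix.

Lemma interleave_prefixS n : s n.+1 = s n ++ w n :: u n.
Proof. by rewrite /s mkseqS flatten_rcons. Qed.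

Lemma size_interleave_prefix n : n <= size (s n).
Proof.
elim: n => // n IH; rewrite interleave_prefixS size_cat /= addnS ltnS.
exact: leq_trans IH (leq_addr _ _).
Qed.

Lemma interleave_prefixD m n :
  s (m + n) = s m ++ flatten (mkseq (fun i => w (m + i) :: u (m + i)) n).
Proof.
elim: n => [|n IH]; first by rewrite addn0 cats0.
by rewrite addnS interleave_prefixS IH mkseqS flatten_rcons catA.
Qed.

Lemma interleave_prefix_nth x0 m n i :
  i < size (s m) -> i < size (s n) -> nth x0 (s m) i = nth x0 (s n) i.
Proof.
wlog le_mn : m n / m <= n => [H hm hn|hm _].
  by case/orP: (leq_total m n) => le; [apply: H | symmetry; apply: H].
by rewrite -(subnKC le_mn) interleave_prefixD nth_cat hm.
Qed.

Lemma interleaved_exists : exists w', interleaved w u w'.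
Proof.
(* The default [w 0] is never reached: each block has at least one letter, so [i.+1] blocks cover
   position [i]. *)
exists (fun i => nth (w 0) (s i.+1) i) => n /=.
apply: (@eq_from_nth _ (w 0)); rewrite size_mkseq // => i hi.
rewrite nth_mkseq //; apply: interleave_prefix_nth => //.
exact: size_interleave_prefix.
Qed.

Variable w' : word A.
Hypothesis ww' : interleaved w u w'.

Lemma interleaved_nth x0 n i : i < size (s n) -> w' i = nth x0 (s n) i.
Proof. by move=> hi; rewrite /s -[X in nth x0 X _](ww' n) nth_mkseq. Qed.

Lemma interleaved_letter n : w' (size (s n)) = w n.
Proof.
rewrite (@interleaved_nth (w n) n.+1) interleave_prefixS.
  by rewrite nth_cat ltnn subnn.
by rewrite size_cat /= addnS ltnS leq_addr.
Qed.

Lemma interleaved_injected n x v : u n = x :: v -> w' (size (s n)).+1 = x.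
Proof.
move=> un; rewrite (@interleaved_nth x n.+1) interleave_prefixS un.
  by rewrite nth_cat ltnNge leqnSn /= subSnn.
by rewrite size_cat /= !addnS !ltnS leq_addr.
Qed.

Lemma interleaved_all (P : pred A) N :
    (forall i, N <= i -> P (w i) && all P (u i)) ->
  forall i, size (s N) <= i -> P (w' i).
Proof.
move=> hP i hi.
have lt_i : i < size (s (N + i.+1)).
  by apply: leq_trans (size_interleave_prefix _); rewrite leq_addl.
rewrite (@interleaved_nth (w 0) _ _ lt_i).
move: lt_i; rewrite interleave_prefixD nth_cat size_cat.
rewrite [i < size (s N)]ltnNge hi /= => lt_i.
have /all_nthP -> // : all P
    (flatten (mkseq (fun j => w (N + j) :: u (N + j)) i.+1)).
  elim: {lt_i} i.+1 => // n IH.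
  by rewrite mkseqS flatten_rcons all_cat IH /= hP // leq_addr.
by rewrite ltn_subLR.
Qed.

End Interleaving.

(** * Residual languages of states in co-Büchi automata *)

Section Automata.
Variable A : Type.

Definition cb_from (B : coBuchi A) (q : cb_state B) : coBuchi A :=
  @CoBuchi A (cb_state B) q (@cb_next A B) (@cb_rej A B) (@cb_complete A B).

Lemma lang_from_wcons (B : coBuchi A) (q : cb_state B) a w :
  lang (cb_from q) (wcons a w) <->
    exists2 q', q' \in cb_next q a & lang (cb_from q') w.
Proof.
split=> [[r [[r0 rS] [N hN]]]|[q' q'q [r [[r0 rS] [N hN]]]]].
  exists (r 1); first by have := rS 0; rewrite r0.
  exists (fun n => r n.+1); split; first by split=> // n; apply: (rS n.+1).
  by exists N => n hn; apply: (hN n.+1); apply: leqW.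
exists (fun n => if n is m.+1 then r m else q); split.
  by split=> // -[|n] /=; [rewrite r0 | apply: rS].
by exists N.+1 => -[|n] // hn; apply: hN.
Qed.

(** From left to right, the advised run on the whole word, cut off after [u], is accepting.
    Conversely, any accepting run from [f u] is prolonged backwards along the advised run on [u]. *)
Lemma hd_lang_from (B : coBuchi A) : history_deterministic B ->
  exists f : seq A -> cb_state B,
    forall u w, lang B (wcat u w) <-> lang (cb_from (f u)) w.
Proof.
case=> f [f0 fS facc]; exists f => u w; split=> [uw|].
  have [N hN] := facc _ uw.
  exists (fun n => f (u ++ mkseq w n)); split.
    by split=> [|n] /=; rewrite ?cats0 // mkseqS -rcons_cat.
  exists N => n hn; have := hN (size u + n).
  by rewrite mkseq_wcat wcat_shift; apply; rewrite (leq_trans hn) ?leq_addl.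
elim/last_ind: u w => [|u a IH] w hw.
  (* Only for a destructed [B] is [cb_from (cb_init B)] convertible to [B]. *)
  by move: hw; rewrite f0; case: (B).
rewrite -cats1 wcat_cat; apply: IH; apply/lang_from_wcons.
by exists (f (rcons u a)).
Qed.

Variables (Q : finType) (d : Q -> A -> Q) (rej : Q -> A -> bool).

Lemma lang_det q w :
  lang (det_coBuchi q d rej) w <->
    exists N, forall n, N <= n -> ~~ rej (foldl d q (mkseq w n)) (w n).
Proof.
split=> [[r [[r0 rS] [N hN]]]|hN].
  exists N => n hn; suff <- : r n = foldl d q (mkseq w n) by apply: hN.
  elim: {hn} n => // n IH; have := rS n.
  by rewrite inE mkseqS foldl_rcons -IH => /eqP.
exists (fun n => foldl d q (mkseq w n)); split=> //.
by split=> // n; rewrite inE mkseqS foldl_rcons.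
Qed.

Lemma lang_det_wcat q u w :
  lang (det_coBuchi q d rej) (wcat u w) <->
    lang (det_coBuchi (foldl d q u) d rej) w.
Proof.
elim: u q => [|a u IH] q //=; rewrite -IH.
rewrite (@lang_from_wcons (det_coBuchi q d rej) q).
by split=> [[q' /set1P ->]|h] //; exists (d q a); rewrite //= inE.
Qed.

End Automata.

Lemma chain_lang_iff (A : Type) n (B : 'I_n.+1 -> coBuchi A) w w' :
  (forall i, lang (B i) w <-> lang (B i) w') ->
  chain_lang B w <-> chain_lang B w'.
Proof.
move=> h; split=> -[h0|[i [hi hj e]]].
- by left=> /h.
- by right; exists i; split=> //; [apply/h | move=> j /hj + /h].
- by left=> /h.
- by right; exists i; split=> //; [apply/h | move=> j /hj + /h].
Qed.

(** * States of the chain and residual languages of L^k *)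

Section Chain.
Variable k : nat.
Implicit Types (w : word (letter k)) (u v p : seq (letter k)) (q : 'I_k).

Definition isX (l : letter k) : bool := if l is LX _ then true else false.

Lemma lang_Aone w :
  lang (Aone k) w <-> exists N, forall n, N <= n -> ~~ isX (w n).
Proof. exact: lang_det. Qed.

(* [A_i] with [i = q.+2], which is the index of the automaton for Y_(q+1). *)
Definition state u q : 'I_3 := foldl (@Anext k q.+2) st0 u.

Lemma chainC_cases (P : nat -> coBuchi (letter k) -> Prop) :
    P 0 (Aone k) -> (forall q, P q.+1 (Alater k q.+2)) ->
  forall t : 'I_k.+1, P t (chainC t).
Proof.
move=> P0 PS t; rewrite /chainC.
by case: (unliftP ord0 t) => [q ->|->] //; apply: PS.
Qed.

(** [A_1] has a single state, so the states of the other automata determine the residual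
    language. *)
Lemma chainC_state u v : (forall q, state u q = state v q) ->
  forall w, @Lk k (wcat u w) <-> @Lk k (wcat v w).
Proof.
move=> uv w; apply: chain_lang_iff.
apply: (chainC_cases (P := fun _ B => lang B (wcat u w) <-> lang B (wcat v w))).
  by rewrite !lang_det_wcat; case: (foldl _ _ u); case: (foldl _ _ v).
by move=> q; rewrite !lang_det_wcat; have := uv q; rewrite /state => ->.
Qed.

Lemma state_cat u v q : state (u ++ v) q = foldl (@Anext k q.+2) (state u q) v.
Proof. exact: foldl_cat. Qed.

Lemma Anext_LY i q :
  @Anext k i.+2 st0 (LY q) = if q == i :> nat then st1 else st0.
Proof. by rewrite /Anext /= subn1 eqSS. Qed.

Lemma Anext_LX i q :
  @Anext k i.+2 st1 (LX q) = if q == i :> nat then st2 else st1.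
Proof. by rewrite /Anext /= subn1 eqSS. Qed.

Lemma foldl_Anext2 i u : foldl (@Anext k i) st2 u = st2.
Proof. by elim: u. Qed.

Lemma foldl_Anext1_Y q (s : seq 'I_k) :
  foldl (@Anext k q.+2) st1 [seq LY i | i <- s] = st1.
Proof. by elim: s. Qed.

Lemma foldl_Anext0_Y q (s : seq 'I_k) :
  foldl (@Anext k q.+2) st0 [seq LY i | i <- s] = if q \in s then st1 else st0.
Proof.
elim: s => //= a s IH; rewrite Anext_LY inE eq_sym val_eqE.
by case: eqP => _ //=; rewrite foldl_Anext1_Y.
Qed.

Lemma foldl_Anext1 i u : let q := foldl (@Anext k i) st1 u in q = st1 \/ q = st2.
Proof.
elim: u => [|l u IH] /=; first by left.
case: l => [j|j|j] //=; rewrite /Anext /=; case: ifP => _ //.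
by rewrite foldl_Anext2; right.
Qed.

(** The witness is the index of the first letter X in [u]; no letter before it leaves [st1]. *)
Lemma foldl_Anext1_X u : has isX u ->
  exists q, foldl (@Anext k q.+2) st1 u = st2.
Proof.
elim: u => //= l u IH; case: l => [j|j|j] /=; try exact: IH.
by move=> _; exists j; rewrite Anext_LX eqxx foldl_Anext2.
Qed.

(** Positions count from 0 here: the last accepting element is [A_(b+1)], whose index is even
    exactly for odd [b]. *)
Lemma Lk_level w b : b <= k ->
  (forall t : 'I_k.+1, lang (chainC t) w <-> t <= b) -> @Lk k w <-> odd b.
Proof.
move=> bk hw; have eb : (inord b : 'I_k.+1) = b :> nat by rewrite inordK.
have hb : lang (chainC (inord b : 'I_k.+1)) w by apply/hw; rewrite eb.
split=> [[h|[i [/hw hi hj]]]|ob].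
- by case: h; apply/hw.
- move: hi; rewrite leq_eqVlt => /orP[/eqP <-|lt_ib]; first by rewrite /= negbK.
  by have := hj (inord b); rewrite eb => /(_ lt_ib).
- right; exists (inord b); rewrite eb; split=> //; last by rewrite /= ob.
  by move=> j bj /hw; rewrite leqNgt bj.
Qed.

Lemma lang_Alater_const i p (j : 'I_(2 * k + 1)) :
  lang (Alater k i) (wcat p (fun=> La j)) <->
    ~~ Arej i (foldl (@Anext k i) st0 p) (La j).
Proof.
rewrite lang_det_wcat lang_det; set q := foldl _ _ p.
have fq n : foldl (@Anext k i) q (mkseq (fun=> La j) n) = q.
  elim: n => // n IH; rewrite mkseqS foldl_rcons IH.
  by rewrite /Anext; case: (val q) => [|[|?]].
split=> [[N /(_ N (leqnn N))]|h]; first by rewrite fq.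
by exists 0 => n _; rewrite fq.
Qed.

Lemma lang_Aone_const p (j : 'I_(2 * k + 1)) :
  lang (Aone k) (wcat p (fun=> La j)).
Proof.
apply/lang_Aone; exists (size p) => n hn.
by rewrite -(subnKC hn) wcat_shift.
Qed.

(** A letter X in [v] would take some [A_i] from q_(i,1) to q_(i,2). On a suitable constant
    continuation this lowers the last accepting position by exactly one and so flips membership in
    L^k. *)
Lemma residual_no_X p v : (forall q, state p q = st1) ->
  same_residual (fun w => ~ @Lk k w) p (p ++ v) -> ~~ has isX v.
Proof.
move=> p1 pv; apply/negP => /foldl_Anext1_X[q v2].
(* The infinitely repeated letter is a_(2k-2i+4) for i = q+2, the only letter a
   whose color differs between [q_(i,1)] and [q_(i,2)]. *)
have hj : 2 * k - 2 * q - 1 < 2 * k + 1 by lia.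
pose j := Ordinal hj; have kq := ltn_ord q.
have Lp : @Lk k (wcat p (fun=> La j)) <-> odd q.+1.
  apply: Lk_level => //.
  apply: (chainC_cases (P := fun t B => lang B _ <-> t <= q.+1)) => [|r].
    by split=> // _; apply: lang_Aone_const.
  by have := p1 r; rewrite lang_Alater_const /state => ->; rewrite /Arej /=; lia.
have Lpv : @Lk k (wcat (p ++ v) (fun=> La j)) <-> odd q.
  apply: Lk_level; first exact: ltnW.
  apply: (chainC_cases (P := fun t B => lang B _ <-> t <= q)) => [|r].
    by split=> // _; apply: lang_Aone_const.
  have := state_cat p v r; rewrite p1 lang_Alater_const /state => ->.
  have [->|/eqP ne] := eqVneq r q; first by rewrite v2 /Arej /=; lia.
  have {}ne : r <> q :> nat by move=> /val_inj.
  (* The other automata give this letter the same color in both states, so it does not matter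
     whether [v] moves them too. *)
  by case: (foldl_Anext1 r.+2 v) => ->; rewrite /Arej /=; lia.
have := pv (fun=> La j); rewrite /residual Lp Lpv /=.
by case: (odd q) => /= -[h1 h2]; [apply: h1 | apply: h2].
Qed.

(** * Words of natural color 0 *)

Lemma top_subproof : 2 * k < 2 * k + 1. Proof. by rewrite addn1. Qed.
Definition top : letter k := La (Ordinal top_subproof).

(** The letter [top] is rejecting in every state of every [A_i] with i >= 2, so [A_1] alone accepts
    [w], and its index is odd. *)
Lemma not_Lk w :
    (forall N, exists2 n, N <= n & w n = top) ->
    (exists N, forall n, N <= n -> ~~ isX (w n)) ->
  ~ @Lk k w.
Proof.
move=> inf_top /lang_Aone fin_X [|[i [hi _]]]; first exact.
move: i hi; apply: (chainC_cases (P := fun i B => lang B w -> ~ ~~ odd i.+1)).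
  by [].
move=> q /lang_det[N hN] _; have [n Nn wn] := inf_top N.
have := hN n Nn; rewrite wn /Arej /=.
by have := ltn_ord q; case: (nat_of_ord (foldl _ _ _)) => [|[|?]]; lia.
Qed.

Lemma at_home0 p : (forall q, state p q = st1) ->
  at_home (fun w => ~ @Lk k w) 0 (wcat p (fun=> top)).
Proof.
move=> p1; set w := wcat p _.
have w_top i : size p <= i -> w i = top by move=> /subnKC <-; rewrite /w wcat_shift.
(* Injections start only after [p], where all automata rest in [st1] and [residual_no_X] applies. *)
apply: (@AtHome _ _ 0 w (fun j => size p <= j)).
  by move=> N; exists (N + size p); rewrite ?leq_addr ?leq_addl.
move=> w' [u [uJ ures ww']]; constructor 2; split=> //.
  apply: not_Lk => [N|].
    by exists (N + size p); rewrite ?leq_addr // w_top // leq_addl.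
  by exists (size p) => n /w_top ->.
apply: not_Lk => [N|].
  exists (size (interleave_prefix w u (N + size p))).
    exact: leq_trans (leq_addr _ _) (size_interleave_prefix _ _ _).
  by rewrite (interleaved_letter ww') w_top // leq_addl.
exists (size (interleave_prefix w u (size p))).
apply: (interleaved_all (P := predC isX) ww') => i hi.
rewrite w_top //= all_predC; apply: residual_no_X (ures i) => q.
rewrite -(subnKC (leqW hi)) mkseq_wcat state_cat p1.
by elim: (_ - _) => // n IH; rewrite mkseqS foldl_rcons IH.
Qed.

(** After [p], injecting [LX q] changes no state: [A_(q+2)] is in a sink and the others ignore this
    letter. Infinitely many injections make [A_1] reject, which puts the word into L^k. *)
Lemma not_at_home0 p q w : state p q = st2 ->
  ~ at_home (fun w => ~ @Lk k w) 0 (wcat p w).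
Proof.
move=> p2; move E0: 0 => z; move E: (wcat p w) => pw hm.
case: hm E0 E => i {}pw J infJ hJ E0 E; rewrite -{i}E0 in hJ.
(* Nothing is injected within [p], where the sink need not have been reached yet. *)
pose u j := if excluded_middle_informative (J j /\ size p <= j)
  then [:: LX q] else [::].
have [w' ww'] := interleaved_exists pw u.
have: injection (fun w => ~ @Lk k w) J pw w'.
  exists u; split=> // j; rewrite /u; case: excluded_middle_informative => /=.
  - by case.
  - by [].
  - case=> _ pj x; rewrite /residual.
    suff h : @Lk k (wcat (mkseq pw j.+1) x) <->
        @Lk k (wcat (mkseq pw j.+1 ++ [:: LX q]) x) by split=> nL /h.
    apply: chainC_state => r; rewrite -E -(subnKC (leqW pj)) mkseq_wcat.
    have [->|/eqP ne] := eqVneq r q; first by rewrite !state_cat p2 !foldl_Anext2.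
    rewrite [RHS]state_cat; move: (state _ r) => s; rewrite /= /Anext.
    case: (val s) => [|[|?]] //=; rewrite subn1 eqSS.
    by case: eqP => // /val_inj e; case: ne.
  - by rewrite cats0.
move/hJ; case=> [[]//|[_ nw' _]|[]//].
apply: nw'; left=> /lang_Aone[N hN].
have [j hj Jj] := infJ (N + size p).
have uj : u j = [:: LX q].
  rewrite /u; case: excluded_middle_informative => // -[]; split=> //.
  exact: leq_trans (leq_addl _ _) hj.
have := hN (size (interleave_prefix pw u j)).+1.
rewrite (interleaved_injected ww' uj) /=; case/(_ _)/negP => //.
apply: leqW; apply: leq_trans (size_interleave_prefix _ _ _).
exact: leq_trans (leq_addr _ _) hj.
Qed.

(** * Separating the sets of letters Y *)

Definition Yword (S : {set 'I_k}) : seq (letter k) := [seq LY q | q <- enum S].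

(** After [Yword S], the letter [LX m] changes no state, as [A_(m+2)] is still in [st0]; the letters
    Y then bring all automata to [st1]. After [Yword T], it sends [A_(m+2)] to [st2]. The second
    claim is doubly negated because [cocoa_color0] speaks of rejection. *)
Lemma Yword_separated n (B : 'I_n.+1 -> coBuchi (letter k)) (S T : {set 'I_k}) m :
    is_cocoa (fun w => ~ @Lk k w) B -> m \notin S -> m \in T ->
  let z := wcat (LX m :: Yword setT) (fun=> top) in
  ~ lang (B ord0) (wcat (Yword S) z) /\ ~ ~ lang (B ord0) (wcat (Yword T) z).
Proof.
move=> [_ _ B0 _] mS mT z; split.
  apply/B0; split=> //; rewrite -wcat_cat; apply: at_home0 => q.
  rewrite state_cat /state /Yword foldl_Anext0_Y mem_enum /=.
  case: ifP => qS; last by rewrite foldl_Anext0_Y mem_enum inE.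
  rewrite Anext_LX; case: eqP => [/val_inj e|_]; last exact: foldl_Anext1_Y.
  by rewrite e qS in mS.
rewrite B0 => -[+ _]; rewrite -wcat_cat; apply: (@not_at_home0 _ m).
rewrite state_cat /state /Yword foldl_Anext0_Y mem_enum mT /=.
by rewrite Anext_LX eqxx foldl_Anext2.
Qed.

End Chain.

Theorem theorem6p2 (k n : nat) (B : 'I_n.+1 -> coBuchi (letter k)) :
  is_cocoa (fun w => ~ @Lk k w) B -> 2 ^ k <= #|cb_state (B ord0)|.
Proof.
move=> cB; have [f hf] := hd_lang_from (cocoa_hd cB ord0).
have sep (S T : {set 'I_k}) : f (Yword S) = f (Yword T) -> T \subset S.
  move=> e; apply/subsetP => m mT; apply/negPn/negP => mS.
  (* Both words continue with the same suffix, so one common state cannot accept it for [T] and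
     reject it for [S]. *)
  have [nS nT] := Yword_separated cB mS mT.
  by apply: nT => /hf; rewrite -e => /hf.
have inj : injective (fun S : {set 'I_k} => f (Yword S)).
  by move=> S T e; apply/eqP; rewrite eqEsubset !sep.
have <- : #|{set 'I_k}| = 2 ^ k.
  by rewrite -cardsT -powersetT card_powerset cardsT card_ord.
exact: leq_card inj.
Qed.
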